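(* Let $X$ be a regular Lindelöf space which is locally null with respect to a $\sigma$-ideal $\mathscr{I}$ of an upper semi-lattice $(\mathscr{L},\subseteq)$, where $\mathscr{L}\subseteq\mathscr{P}(X)$. Then $C^{\mathscr I}_0(X)$ is a Banach algebra isometrically isomorphic to $C_0(Y)$ for the unique (up to homeomorphism) locally compact Hausdorff space \[Y=\bigcup\{\mathrm{int}_{\beta X}\mathrm{cl}_{\beta X}U:U\text{ is null}\},\] considered as a subspace of $\beta X$. Furthermore: (1) $X$ is dense in $Y$ (in particular $X\subseteq Y$). (2) $C^{\mathscr I}_0(X)=C^{\mathscr I}_{00}(X)$. (3) $C_0(Y)=C_{00}(Y)$. (4) $Y$ is countably compact; and $Y$ is compact if and only if $\mathscr{I}$ is non-proper if and only if $C^{\mathscr I}_0(X)$ is unital.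
   Context: A space is a topological space; regular spaces are taken to be Hausdorff (so regular Lindelöf spaces are normal Hausdorff), and $\beta X$ denotes the Stone–Čech compactification of $X$, which contains $X$ as a dense subspace. $\mathscr{P}(X)$ is the power set of $X$. $C_b(X)$ is the normed algebra of continuous bounded $f:X\to\mathbb{R}$ with pointwise operations and the supremum norm. For $f\in C_b(X)$: $\mathrm{coz}(f)=X\setminus f^{-1}(0)$ and $\mathrm{supp}(f)=\mathrm{cl}_X\mathrm{coz}(f)$. $C_0(Y)$ is the set of $f\in C_b(Y)$ vanishing at infinity, i.e. with $|f|^{-1}([1/n,\infty))$ compact for each positive integer $n$, and $C_{00}(Y)$ is the set of $f\in C_b(Y)$ with compact support. ''Isometrically isomorphic'' means by an isometric algebra isomorphism. A space is countably compact if every countable open cover has a finite subcover. An upper semi-lattice is a partially ordered set in which any two elements $A,B$ have a least upper bound $A\vee B$. For $\mathscr{L}\subseteq\mathscr{P}(X)$ ordered by inclusion, least upper bounds are computed in $\mathscr{L}$ and need not be unions. An ideal $\mathscr{I}$ in $(\mathscr{L},\subseteq)$ is a non-empty subset of $\mathscr{L}$ such that $A\vee B\in\mathscr{I}$ whenever $A,B\in\mathscr{I}$, and $T\in\mathscr{I}$ whenever $T\in\mathscr{L}$ and $T\subseteq A$ for some $A\in\mathscr{I}$. When $\mathscr{L}$ contains least upper bounds of all its countable subsets (this is part of the assumption whenever $\sigma$-ideals are mentioned), $\mathscr{I}$ is a $\sigma$-ideal if moreover $\bigvee\mathscr{J}\in\mathscr{I}$ for every countable $\mathscr{J}\subseteq\mathscr{I}$.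 Elements of $\mathscr{I}$ are called null; $\mathscr{I}$ is non-proper if $X\in\mathscr{I}$. A neighborhood of a set $A$ in $X$ is a set $U\subseteq X$ with $A\subseteq\mathrm{int}_XU$. $X$ is locally null (with respect to $\mathscr{I}$) if every point of $X$ has a null neighborhood in $X$. $C^{\mathscr I}_{00}(X)=\{f\in C_b(X):\mathrm{supp}(f)\text{ has a null neighborhood in }X\}$. $C^{\mathscr I}_0(X)=\{f\in C_b(X):|f|^{-1}([1/n,\infty))\text{ has a null neighborhood in }X\text{ for each positive integer }n\}$. An algebra is unital if it has a multiplicative unit element. *)

(* Defs.v *)
From HB Require Import structures.
From mathcomp Require Import all_boot all_order all_algebra.
From mathcomp Require Import all_classical all_reals all_analysis.
Set Implicit Arguments.
Unset Strict Implicit.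
Unset Printing Implicit Defensive.
Import Order.TTheory GRing.Theory Num.Theory.
Import numFieldNormedType.Exports.
Local Open Scope classical_set_scope.
Local Open Scope ring_scope.

(* The normed algebra C_b(X).  X may be empty, in which case the algebra is
   trivial; this is why it is only a comPzRingType. *)

Section BoundedContinuous.
Variables (R : realType) (X : topologicalType).

Definition cb_pred : {pred X -> R} :=
  mem [set f : X -> R | continuous f /\ bounded_fun f].

Structure Cb := MkCb { cb_fun :> X -> R; _ : cb_fun \in cb_pred }.

HB.instance Definition _ := [isSub for cb_fun].
HB.instance Definition _ := [Choice of Cb by <:].

Lemma cb_boundP (f : X -> R) :
  bounded_fun f <-> exists M : R, forall x, `|f x| <= M.
Proof.
split=> [[M [_ hM]]|[M hM]].
  exists (M + 1) => x; by apply: hM => //; rewrite ltrDl.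
by exists M; split=> [|N MN x _]; [rewrite num_real|exact: le_trans (hM x) (ltW MN)].
Qed.

Lemma cb_subring_closed : subring_closed cb_pred.
Proof.
split.
- rewrite inE; split; first by move=> x; exact: cvg_cst.
  by apply/cb_boundP; exists 1 => x /=; rewrite normr1.
- move=> f g; rewrite !inE => -[cf /cb_boundP[M hM]] [cg /cb_boundP[N hN]].
  split; first by move=> x; apply: cvgB; [exact: cf|exact: cg].
  apply/cb_boundP; exists (M + N) => x /=.
  by rewrite (le_trans (ler_normB _ _))// lerD.
- move=> f g; rewrite !inE => -[cf /cb_boundP[M hM]] [cg /cb_boundP[N hN]].
  split; first by move=> x; apply: cvgM; [exact: cf|exact: cg].
  by apply/cb_boundP; exists (M * N) => x /=; rewrite normrM ler_pM.
Qed.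

HB.instance Definition _ :=
  GRing.isSubringClosed.Build (X -> R) cb_pred cb_subring_closed.
HB.instance Definition _ := [SubChoice_isSubZmodule of Cb by <:].
HB.instance Definition _ :=
  GRing.SubZmodule_isSubPzRing.Build (X -> R) cb_pred Cb cb_subring_closed.
HB.instance Definition _ :=
  GRing.SubPzRing_isSubComPzRing.Build (X -> R) cb_pred Cb.

Lemma cb_scaler_closed : GRing.scaler_closed cb_pred.
Proof.
move=> k f; rewrite !inE => -[cf /cb_boundP[M hM]].
split; first by move=> x; apply: cvgM; [exact: cvg_cst|exact: cf].
by apply/cb_boundP; exists (`|k| * M) => x /=; rewrite normrM ler_wpM2l.
Qed.

HB.instance Definition _ :=
  GRing.isScaleClosed.Build R (X -> R) cb_pred cb_scaler_closed.
HB.instance Definition _ := [SubZmodule_isSubLmodule of Cb by <:].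

(* sup set0 = 0, so the norm is 0 when X is empty *)
Definition cb_norm (f : Cb) : R := sup (range (fun x => `|f x|)).

Lemma cb_has_sup (f : Cb) (x0 : X) : has_sup (range (fun x => `|f x|)).
Proof.
split; first by exists `|f x0|; exists x0.
case: f => f /= /set_mem[_ /cb_boundP[M hM]].
by exists M => _ [x _ <-].
Qed.

Lemma cb_le_norm (f : Cb) (x : X) : `|f x| <= cb_norm f.
Proof. by apply: sup_ubound; [case: (cb_has_sup f x)|exists x]. Qed.

Lemma cb_norm_le (f : Cb) (M : R) :
  0 <= M -> (forall x, `|f x| <= M) -> cb_norm f <= M.
Proof.
move=> M0 hM; rewrite /cb_norm.
have [->|ne] := eqVneq (range (fun x => `|f x|)) set0; first by rewrite sup0.
by apply: ge_sup => [|_ [x _ <-]//]; exact/set0P.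
Qed.

Lemma cb_norm_ge0 (f : Cb) : 0 <= cb_norm f.
Proof.
rewrite /cb_norm.
have [->|/set0P[_ [x _ _]]] := eqVneq (range (fun x => `|f x|)) set0.
  by rewrite sup0.
exact: le_trans (normr_ge0 _) (cb_le_norm f x).
Qed.

Lemma cb_normD (f g : Cb) : cb_norm (f + g) <= cb_norm f + cb_norm g.
Proof.
apply: cb_norm_le => [|x]; first by rewrite addr_ge0 ?cb_norm_ge0.
exact: le_trans (ler_normD _ _) (lerD (cb_le_norm f x) (cb_le_norm g x)).
Qed.

Lemma cb_normZ (k : R) (f : Cb) : cb_norm (k *: f) = `|k| * cb_norm f.
Proof.
have le_Z (l : R) (g : Cb) : cb_norm (l *: g) <= `|l| * cb_norm g.
  apply: cb_norm_le => [|x]; first by rewrite mulr_ge0 ?cb_norm_ge0.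
  have -> : (l *: g) x = l * g x by [].
  by rewrite normrM ler_wpM2l// cb_le_norm.
apply/eqP; rewrite eq_le le_Z/=.
have [->|k0] := eqVneq k 0; first by rewrite normr0 mul0r cb_norm_ge0.
have := le_Z k^-1 (k *: f).
rewrite scalerA mulVf// scale1r normfV => h.
by rewrite -ler_pdivlMl ?normr_gt0.
Qed.

Lemma cb_norm0_eq0 (f : Cb) : cb_norm f = 0 -> f = 0.
Proof.
move=> f0; apply/val_inj/funext => x /=.
by apply/eqP; rewrite -normr_le0 -f0 cb_le_norm.
Qed.

HB.instance Definition _ :=
  Lmodule_isNormed.Build R Cb cb_normD cb_normZ cb_norm0_eq0.

End BoundedContinuous.

Section Algebras.
Variable R : realType.

(* A is a Banach algebra for the operations and the norm of C_b(X). *)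
Record banach_algebra (X : topologicalType) (A : set (Cb R X)) : Prop := {
  ba_0 : A 0;
  ba_D : forall f g, A f -> A g -> A (f + g);
  ba_Z : forall (k : R) f, A f -> A (k *: f);
  ba_M : forall f g, A f -> A g -> A (f * g);
  ba_normM : forall f g, A f -> A g -> `|f * g| <= `|f| * `|g|;
  ba_complete : forall u : nat -> Cb R X, (forall n, A (u n)) ->
    cauchy (u @ \oo) -> exists2 f, A f & u @ \oo --> f }.

Definition unital (X : topologicalType) (A : set (Cb R X)) : Prop :=
  exists2 u, A u & forall f, A f -> u * f = f /\ f * u = f.

(* Only the values of phi on A matter. *)
Record isometric_isomorphism (X Y : topologicalType)
    (A : set (Cb R X)) (B : set (Cb R Y)) (phi : Cb R X -> Cb R Y) : Prop := {
  iso_bij : set_bij A B phi;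
  iso_D : forall f g, A f -> A g -> phi (f + g) = phi f + phi g;
  iso_Z : forall (k : R) f, A f -> phi (k *: f) = k *: phi f;
  iso_M : forall f g, A f -> A g -> phi (f * g) = phi f * phi g;
  iso_norm : forall f, A f -> `|phi f| = `|f| }.

Definition isometrically_isomorphic (X Y : topologicalType)
    (A : set (Cb R X)) (B : set (Cb R Y)) : Prop :=
  exists phi, isometric_isomorphism A B phi.

End Algebras.

Section Topology.

Definition lindelof (X : topologicalType) : Prop :=
  forall C : set (set X), (forall U, C U -> open U) ->
    \bigcup_(U in C) U = [set: X] ->
    exists D : set (set X),
      [/\ D `<=` C, countable D & \bigcup_(U in D) U = [set: X]].

Definition countably_compact (X : topologicalType) : Prop :=
  forall C : set (set X), countable C -> (forall U, C U -> open U) ->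
    \bigcup_(U in C) U = [set: X] ->
    exists D : set (set X),
      [/\ D `<=` C, finite_set D & \bigcup_(U in D) U = [set: X]].

Definition homeomorphic (X Y : topologicalType) : Prop :=
  exists (f : X -> Y) (g : Y -> X),
    [/\ continuous f, continuous g, cancel f g & cancel g f].

Definition embedding (X Y : topologicalType) (e : X -> Y) : Prop :=
  [/\ injective e, continuous e &
    forall U, open U -> exists2 V, open V & U = e @^-1` V].

(* (bX, e) is the Stone-Cech compactification of X: the compactification to
   which every bounded continuous real function extends.  X is regarded as a
   subspace of bX through e. *)
Record stone_cech (R : realType) (X bX : topologicalType) (e : X -> bX) :
    Prop := {
  sc_compact : compact [set: bX];
  sc_hausdorff : hausdorff_space bX;
  sc_embedding : embedding e;
  sc_dense : dense (range e);
  sc_extend : forall f : Cb R X,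
    exists2 F : bX -> R, continuous F & forall x, F (e x) = f x }.

End Topology.

Section Ideals.
Variable X : Type.
Implicit Types (L I J : set (set X)).

Definition is_join L J (S : set X) : Prop :=
  [/\ L S, (forall A, J A -> A `<=` S) &
    forall T, L T -> (forall A, J A -> A `<=` T) -> S `<=` T].

Definition upper_semilattice L : Prop :=
  forall A B, L A -> L B -> exists S, is_join L [set A; B] S.

Definition countable_joins L : Prop :=
  forall J, J `<=` L -> countable J -> exists S, is_join L J S.

Record ideal L I : Prop := {
  ideal_sub : I `<=` L;
  ideal_nonempty : I !=set0;
  ideal_join : forall A B S, I A -> I B -> is_join L [set A; B] S -> I S;
  ideal_down : forall A T, I A -> L T -> T `<=` A -> I T }.

Record sigma_ideal L I : Prop := {
  sigma_ideal_ideal : ideal L I;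
  sigma_ideal_countable_joins : countable_joins L;
  sigma_ideal_join : forall J S, J `<=` I -> countable J ->
    is_join L J S -> I S }.

End Ideals.

Section NullFunctions.
Variables (R : realType) (X : topologicalType).
Implicit Types (I : set (set X)) (f : Cb R X).

Definition has_null_nbhd I (A : set X) : Prop :=
  exists2 U, I U & A `<=` U°.

Definition locally_null I : Prop := forall x : X, has_null_nbhd I [set x].

Definition coz f : set X := ~` (f @^-1` [set 0]).

Definition supp f : set X := closure (coz f).

Definition level f (n : nat) : set X := [set x | n%:R^-1 <= `|f x|].

Definition C00I I : set (Cb R X) := [set f | has_null_nbhd I (supp f)].

Definition C0I I : set (Cb R X) :=
  [set f | forall n, (0 < n)%N -> has_null_nbhd I (level f n)].

Definition C00 : set (Cb R X) := [set f | compact (supp f)].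

Definition C0 : set (Cb R X) :=
  [set f | forall n, (0 < n)%N -> compact (level f n)].

End NullFunctions.

Definition null_hull (X bX : topologicalType) (e : X -> bX)
    (I : set (set X)) : set bX :=
  \bigcup_(U in I) (closure (e @` U))°.

(* set_type carries the subspace topology *)
Definition null_space (X bX : topologicalType) (e : X -> bX)
    (I : set (set X)) : topologicalType :=
  set_type (null_hull e I).

(* Main.v *)
Require Import Defs.
From HB Require Import structures.
From mathcomp Require Import all_boot all_order all_algebra.
From mathcomp Require Import all_classical all_reals all_analysis.
Set Implicit Arguments.
Unset Strict Implicit.
Unset Printing Implicit Defensive.
Import Order.TTheory GRing.Theory Num.Theory.
Import numFieldNormedType.Exports.
Local Open Scope classical_set_scope.
Local Open Scope ring_scope.

(** A countable family of null sets has a join in the semi-lattice, this join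
    is null, and it contains every member of the family.  By the Lindelöf
    property countably many null sets cover X, so X itself is null
    ([lindelof_locally_null_total]).  Since X is dense in its Stone–Čech
    compactification bX, the space Y is then all of bX ([null_hull_total]), in
    particular it is compact, and every condition asking for a null
    neighborhood or a compact set holds for all bounded continuous functions:
    the four algebras in the theorem are C_b(X), C_b(X), C_b(Y) and C_b(Y).

    What remains is classical.  C_b(X) is complete because a uniform limit of
    continuous functions is continuous ([cb_cauchy_cvg]).  Restriction from bX
    to X is isometric by density and onto by the extension property
    ([dense_extension_iso]).  For uniqueness, if C_0(Z) is isomorphic to
    C_b(X), it is unital, which makes Z compact ([unital_C0_compact]); two
    compact Hausdorff spaces with isomorphic algebras are homeomorphic
    ([banach_stone]), because a point of such a space is the same thing as a
    character of its algebra ([compact_character]). *)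

(** * Covers and null sets *)

Section Spaces.

(** A join need not be a union, but it is an upper bound; this is enough for
    the join of a countable null cover to be the whole space. *)
Lemma lindelof_locally_null_total (X : topologicalType) (L I : set (set X)) :
  lindelof X -> sigma_ideal L I -> locally_null I -> I [set: X].
Proof.
move=> lX sI nX.
have [||D [DC cD DT]] := lX [set V | open V /\ exists2 U, I U & V = U°].
- by move=> V [].
- apply/seteqP; split=> // x _; have [U IU xU] := nX x.
  by exists (U°); [split; [exact: open_interior|exists U]|exact: xU].
(* Each member of the countable subcover is the interior of some null set. *)
have choose_null V : exists U, D V -> I U /\ V = U°.
  have [/DC[_ [U IU VU]]|nDV] := pselect (D V); first by exists U.
  by exists set0.
have {choose_null}[u hu] := choice choose_null.
have uDI : u @` D `<=` I by move=> _ [V /hu[IU _] <-].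
have cuD : countable (u @` D) by exact: card_le_trans (card_image_le _ _) cD.
have [S jS] := sigma_ideal_countable_joins sI
  (subset_trans uDI (ideal_sub (sigma_ideal_ideal sI))) cuD.
have IS := sigma_ideal_join sI uDI cuD jS.
have [_ ubS _] := jS.
suff <- : S = [set: X] by [].
apply/seteqP; split=> // x xT; move: xT; rewrite -DT => -[V DV Vx].
apply: (ubS (u V)); first by exists V.
by apply: interior_subset; have [_ <-] := hu _ DV.
Qed.

(** The near-covering form of compactness, applied to the filter of tails of
    the directed set of finite subfamilies of C. *)
Lemma compact_countably_compact (T : topologicalType) :
  compact [set: T] -> countably_compact T.
Proof.
move=> /compact_near_coveringP cT C _ oC CT.
pose fin D := D `<=` C /\ finite_set D.
pose F := filter_from fin (fun D => [set E | fin E /\ D `<=` E]).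
have FF : Filter F.
  apply: filter_from_filter; first by exists set0; split=> //; exact: finite_set0.
  move=> D E [DC fD] [EC fE]; exists (D `|` E).
    by split; [rewrite subUset|rewrite finite_setU].
  by move=> G [finG]; rewrite subUset => -[? ?]; split.
have [x _|D [DC fD] /(_ D) DP] := cT _ F (fun D x => (\bigcup_(U in D) U) x) FF.
  have : [set: T] x by [].
  rewrite -CT => -[U CU Ux].
  exists (U, [set E | fin E /\ [set U] `<=` E]).
    split; first by apply: open_nbhs_nbhs; split; [exact: oC|].
    by exists [set U] => //; split; [move=> _ ->|exact: finite_set1].
  by move=> [y E] /= [Uy [_ UE]]; exists U => //; exact: UE.
exists D; split=> //; apply/seteqP; split=> // x xT.
exact: (DP (conj (conj DC fD) (@subset_refl _ D)) x xT).
Qed.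

Lemma compact_locally_compact (T : topologicalType) :
  compact [set: T] -> locally_compact [set: T].
Proof.
move=> cT x _; exists [set: T]; first exact: filterT.
by split=> //; exact: closedT.
Qed.

End Spaces.

(** * The normed algebra of bounded continuous functions *)

Section Cb.
Variable R : realType.
Implicit Types X Y Z : topologicalType.

Lemma cb_continuous X (f : Cb R X) : continuous f.
Proof. by case: f => f /= /set_mem[]. Qed.

Definition cb_of X (f : X -> R) (cf : continuous f) (bf : bounded_fun f) :
  Cb R X := MkCb (mem_set (conj cf bf)).

Lemma cbP X (f g : Cb R X) : f =1 g -> f = g.
Proof. by move=> fg; apply/val_inj/funext. Qed.

Lemma cb_norm_mul X (f g : Cb R X) : `|f * g| <= `|f| * `|g|.
Proof.
apply: cb_norm_le => [|x]; first by rewrite mulr_ge0.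
have -> : (f * g) x = f x * g x by [].
by rewrite normrM ler_pM //; exact: cb_le_norm.
Qed.

(** A Cauchy sequence for the sup norm is pointwise Cauchy, and its pointwise
    limit is a uniform limit, hence continuous. *)
Lemma cb_cauchy_cvg X (u : nat -> Cb R X) :
  cauchy (u @ \oo) -> exists f : Cb R X, u @ \oo --> f.
Proof.
move=> /cauchyP cu.
have dist_le (f g : Cb R X) x : `|f x - g x| <= `|f - g|.
  exact: (cb_le_norm (f - g) x).
have near_u e : 0 < e -> exists g, \forall n \near \oo, `|g - u n| <= e.
  move=> /cu[g gu]; exists g; near=> n; apply: ltW.
  suff : ball g e (u n) by rewrite -ball_normE.
  by near: n.
have cux x : cvg ((fun n => u n x) @ \oo).
  apply/cauchy_cvgP/cauchy_exP => e e0.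
  have [g gu] := near_u (e / 2) ltac:(by rewrite divr_gt0).
  exists (g x); apply: filterS gu => n gun.
  rewrite -ball_normE /=; apply: le_lt_trans (dist_le _ _ _) _.
  by apply: le_lt_trans gun _; rewrite gtr_pMr // invf_lt1 // ltr1n.
pose f x := lim ((fun n => u n x) @ \oo).
have unif e : 0 < e -> \forall n \near \oo, forall x, `|f x - u n x| <= e.
  move=> e0; have [g gu] := near_u (e / 2) ltac:(by rewrite divr_gt0).
  have gf x : `|g x - f x| <= e / 2.
    have cvg_gu : `|g x - u n x| @[n --> \oo] --> `|g x - f x|.
      by apply: cvg_norm; apply: cvgB; [exact: cvg_cst|exact: cux].
    apply: (@closed_cvg _ _ _ _ _ [set r : R | r <= e / 2] _ _ _ cvg_gu).
      exact: closed_le.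
    by apply: filterS gu => n; apply: le_trans; exact: dist_le.
  near=> n => x; rewrite (splitr e) -(subrKA (g x)).
  apply: le_trans (ler_normD _ _) _; apply: lerD; first by rewrite distrC.
  by apply: le_trans (dist_le _ _ _) _; near: n.
have cf : continuous f.
  apply: (@uniform_limit_continuous _ _ ((fun n => u n : X -> R) @ \oo)).
    by near_simpl; apply: nearW => n; exact: cb_continuous.
  move=> A /uniform_nbhs[E [entE EA]].
  have [e e0 eE] : exists2 e : R, 0 < e & forall x y, `|x - y| < e -> E (x, y).
    move: entE; rewrite -entourage_ballE => -[e e0 eE]; exists e => // x y xy.
    by apply: eE; rewrite /= -ball_normE.
  near=> n; apply: EA => x _; apply: eE.
  apply: (@le_lt_trans _ _ (e / 2)); last first.
    by rewrite gtr_pMr // invf_lt1 // ltr1n.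
  by move: x; near: n; apply: unif; rewrite divr_gt0.
have bf : bounded_fun f.
  apply/cb_boundP; have [n _ /(_ n (leqnn _)) un] := unif 1 ltr01.
  exists (1 + `|u n|) => x; rewrite -(subrK (u n x) (f x)).
  by apply: le_trans (ler_normD _ _) _; rewrite lerD //; exact: cb_le_norm.
exists (cb_of cf bf); apply/cvgrPdist_le => e e0.
near=> n; apply: cb_norm_le; first exact: ltW.
by near: n; exact: unif.
Unshelve. all: by end_near. Qed.

Lemma compact_bounded_fun X (f : X -> R) :
  compact [set: X] -> continuous f -> bounded_fun f.
Proof.
move=> cX cf; have := compact_bounded
  (continuous_compact (continuous_subspaceT cf) cX).
rewrite /bounded_set /= => -[M [Mr hM]]; exists M; split=> // N MN x _ /=.
by apply: (hM _ MN); exists x.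
Qed.

(** Complete regularity in the form of a bump function: 1 at the point and 0
    outside the neighborhood. *)
Lemma lc_separation Z (z : Z) (U : set Z) :
  locally_compact [set: Z] -> hausdorff_space Z -> nbhs z U ->
  exists2 f : Cb R Z, f z = 1 & forall y, ~ U y -> f y = 0.
Proof.
move=> lZ hZ Uz.
have : uniform_separator [set z] (~` U°).
  apply: (@locally_compact_completely_regular Z R) => //.
  exact/open_closedC/open_interior.
move=> /(uniform_separatorP (R := R))[g [cg g01 g0 g1]].
have bg : bounded_fun g.
  apply/cb_boundP; exists 1 => x; have : range g (g x) by exists x.
  by move=> /g01 /=; rewrite in_itv/= => /andP[? ?]; rewrite ger0_norm.
exists (1 - cb_of cg bg) => [|y nUy].
  by rewrite -[LHS]/(1 - g z) (g0 (g z)) ?subr0//; exists z.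
rewrite -[LHS]/(1 - g y) (g1 (g y)) ?subrr//.
by exists y => // /interior_subset.
Qed.

End Cb.

(** * Isometric isomorphisms *)

Section Isomorphisms.
Variable R : realType.
Implicit Types X Y Z T : topologicalType.

Lemma cb_banach X : banach_algebra [set: Cb R X].
Proof.
split=> //; first by move=> f g _ _; exact: cb_norm_mul.
by move=> u _ /cb_cauchy_cvg[f uf]; exists f.
Qed.

(** The inverse is returned together with the cancellation laws, since
    [banach_stone] needs the two point maps to come from mutually inverse
    isomorphisms. *)
Lemma iso_inverse X Y (A : set (Cb R X)) (B : set (Cb R Y)) phi :
  banach_algebra A -> isometric_isomorphism A B phi ->
  exists psi, [/\ isometric_isomorphism B A psi,
    forall f, A f -> psi (phi f) = f & forall g, B g -> phi (psi g) = g].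
Proof.
move=> bA [[pAB pinj psur] pD pZ pM pN].
have inv g : exists f, B g -> A f /\ phi f = g.
  have [/psur[f Af fg]|nBg] := pselect (B g); first by exists f.
  by exists 0.
have {inv}[psi hpsi] := choice inv.
have psiA g : B g -> A (psi g) by move=> /hpsi[].
have psiK g : B g -> phi (psi g) = g by move=> /hpsi[].
have phiK f : A f -> psi (phi f) = f.
  move=> Af; have Bf := pAB _ Af.
  by apply: pinj; rewrite ?inE ?psiK//; exact: psiA.
exists psi; split=> //; split.
- split.
  + by move=> g /psiA.
  + by move=> f g /set_mem Bf /set_mem Bg fg; rewrite -(psiK f) // fg psiK.
  + by move=> f Af; exists (phi f); [exact: pAB|exact: phiK].
- move=> f g Bf Bg; rewrite -[in LHS](psiK f) // -[in LHS](psiK g) //.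
  by rewrite -pD ?phiK//; [apply: ba_D => //|..]; exact: psiA.
- move=> k f Bf; rewrite -[in LHS](psiK f) // -pZ ?phiK//.
    by apply: ba_Z => //; exact: psiA.
  exact: psiA.
- move=> f g Bf Bg; rewrite -[in LHS](psiK f) // -[in LHS](psiK g) //.
  by rewrite -pM ?phiK//; [apply: ba_M => //|..]; exact: psiA.
- by move=> f Bf; rewrite -[in RHS](psiK f) // pN //; exact: psiA.
Qed.

Lemma iso_sym X Y (A : set (Cb R X)) (B : set (Cb R Y)) :
  banach_algebra A ->
  isometrically_isomorphic A B -> isometrically_isomorphic B A.
Proof.
by move=> bA [phi iphi]; have [psi [? _ _]] := iso_inverse bA iphi; exists psi.
Qed.

Lemma iso_trans X Y Z (A : set (Cb R X)) (B : set (Cb R Y))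
    (C : set (Cb R Z)) :
  isometrically_isomorphic A B -> isometrically_isomorphic B C ->
  isometrically_isomorphic A C.
Proof.
move=> [phi [pb pD pZ pM pN]] [psi [qb qD qZ qM qN]].
have [pAB _ _] := pb.
exists (psi \o phi); split=> /=.
- exact: set_bij_comp pb qb.
- by move=> f g Af Ag; rewrite pD // qD //; exact: pAB.
- by move=> k f Af; rewrite pZ // qZ //; exact: pAB.
- by move=> f g Af Ag; rewrite pM // qM //; exact: pAB.
- by move=> f Af; rewrite qN ?pN //; exact: pAB.
Qed.

Lemma iso_unital X Y (A : set (Cb R X)) (B : set (Cb R Y)) :
  isometrically_isomorphic A B -> unital A -> unital B.
Proof.
move=> [phi [[pAB _ psur] _ _ pM _]] [u Au uA].
exists (phi u); first exact: pAB.
by move=> _ /psur[f Af <-]; rewrite -!pM //; have [-> ->] := uA f Af.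
Qed.

(** * Algebras over a compact space *)

Lemma compact_C0E T : compact [set: T] -> @C0 R T = [set: Cb R T].
Proof.
move=> cT; apply/seteqP; split=> // f _ n _.
apply: (subclosed_compact _ cT) => //.
have cf : continuous (fun x => `|f x|).
  by move=> x; apply: cvg_norm; exact: cb_continuous.
by apply: (@preimage_closed _ _ _ [set r : R | n%:R^-1 <= r]);
  [move=> x _; exact: cf|exact: closed_ge].
Qed.

Lemma compact_C00E T : compact [set: T] -> @C00 R T = [set: Cb R T].
Proof.
move=> cT; apply/seteqP; split=> // f _.
by apply: (subclosed_compact _ cT) => //; exact: closed_closure.
Qed.

(** At every point some function of C_0 does not vanish, which forces the unit
    to be the constant 1; compactness is then the condition that its level set
    of index 1 be compact. *)
Lemma unital_C0_compact T :
  locally_compact [set: T] -> hausdorff_space T ->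
  unital (@C0 R T) -> compact [set: T].
Proof.
move=> lT hT [u C0u uid].
suff u1 x : u x = 1.
  rewrite (_ : [set: T] = level u 1); first exact: C0u.
  by apply/seteqP; split=> // x _; rewrite /level /= u1 normr1 invr1.
have [K] := lT x I.
rewrite withinET => xK [cK clK].
have [f fx f0] := lc_separation R lT hT xK.
have C0f : C0 f.
  move=> n n0; have : level f n `<=` K.
    move=> y; rewrite /level /= => fy; apply: contrapT => /f0 fy0.
    by move: fy; rewrite fy0 normr0 invr_le0 leNgt ltr0n n0.
  apply: subclosed_compact cK.
  apply: (@preimage_closed _ _ (fun x => `|f x|) [set r : R | n%:R^-1 <= r]).
    by move=> y _; apply: cvg_norm; exact: cb_continuous.
  exact: closed_ge.
have [uf _] := uid f C0f.
have : (u * f) x = f x by rewrite uf.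
by rewrite -[LHS]/(u x * f x) fx mulr1.
Qed.

(** The zero sets of the functions in the kernel of chi generate a proper
    filter: f^2 + g^2 vanishes exactly where both f and g do, and a function
    of the kernel without zeros would be invertible.  By compactness all these
    functions vanish at a common point x; apply this to f - chi(f). *)
Lemma compact_character T (chi : Cb R T -> R) :
  compact [set: T] ->
  {morph chi : f g / f + g} -> {morph chi : f g / f * g} ->
  (forall k f, chi (k *: f) = k * chi f) -> chi 1 = 1 ->
  exists x, forall f, chi f = f x.
Proof.
move=> cT chiD chiM chiZ chi1.
pose F := filter_from [set f | chi f = 0] (fun f => [set x | f x = 0]).
have FF : ProperFilter F.
  apply: filter_from_proper.
    apply: filter_from_filter.
      by exists 0; rewrite /= -(scale0r 0) chiZ mul0r.
    move=> f g /= f0 g0; exists (f * f + g * g).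
      by rewrite /= chiD !chiM f0 g0 !mul0r addr0.
    move=> x; rewrite /= -[X in X = 0]/(f x * f x + g x * g x) -!expr2.
    move=> /eqP; rewrite paddr_eq0 ?sqr_ge0 // !sqrf_eq0.
    by move=> /andP[/eqP ? /eqP ?].
  move=> f /= f0; apply: contrapT => nf.
  have {}nf x : f x != 0 by apply/eqP => fx; apply: nf; exists x.
  have cV : continuous (fun x => (f x)^-1).
    by move=> x; apply: cvgV => //; exact: cb_continuous.
  pose h := cb_of cV (compact_bounded_fun cT cV).
  have fh : f * h = 1.
    by apply: cbP => x; rewrite -[LHS]/(f x * (f x)^-1) divff.
  by move: chi1; rewrite -fh chiM f0 mul0r => /esym/eqP; rewrite oner_eq0.
have [x [_ Fx]] := cT F FF filterT.
have ker f : chi f = 0 -> f x = 0.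
  move=> f0.
  apply: (@preimage_closed _ _ f [set 0]).
  - by move=> y _; exact: cb_continuous.
  - exact: closed_eq.
  - by move=> B xB; apply: Fx => //; exists f.
exists x => f.
have : (f + (- chi f) *: (1 : Cb R T)) x = 0.
  by apply: ker; rewrite chiD chiZ chi1 mulr1 subrr.
by rewrite -[LHS]/(f x + - chi f * 1) mulr1 => /subr0_eq ->.
Qed.

Lemma cb_separates Z (x y : Z) :
  compact [set: Z] -> hausdorff_space Z ->
  (forall f : Cb R Z, f x = f y) -> x = y.
Proof.
move=> cZ hZ xy; apply: (hZ) => A B xA yB.
have [f fx f0] := lc_separation R (compact_locally_compact cZ) hZ xA.
exists y; split; last exact: nbhs_singleton.
by apply: contrapT => /f0; rewrite -xy fx => /eqP; rewrite oner_eq0.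
Qed.

(** Bump functions determine the topology of a compact Hausdorff space. *)
Lemma cb_continuous_into T Z (h : T -> Z) :
  compact [set: Z] -> hausdorff_space Z ->
  (forall f : Cb R Z, continuous (f \o h)) -> continuous h.
Proof.
move=> cZ hZ ch x U xU.
have [f fx f0] := lc_separation R (compact_locally_compact cZ) hZ xU.
have : \forall y \near x, f (h y) != 0.
  apply: (ch f x [set r | r != 0]).
  apply: open_nbhs_nbhs; split; last by rewrite /= fx oner_neq0.
  exact: open_neq.
by apply: filterS => y; apply: contraPP => /f0 ->; rewrite eqxx.
Qed.

(** A homomorphism onto C_b(Z) preserves the unit, so following it by
    evaluation at z gives a character of C_b(Y), that is, a point h(z). *)
Lemma compact_dual_map Y Z (phi : Cb R Y -> Cb R Z) :
  compact [set: Y] -> hausdorff_space Y ->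
  isometric_isomorphism [set: Cb R Y] [set: Cb R Z] phi ->
  exists2 h : Z -> Y, continuous h & forall (f : Cb R Y) z, f (h z) = phi f z.
Proof.
move=> cY hY [[_ _ psur] pD pZ pM _].
have phi1 : phi 1 = 1.
  have [f _ f1] : [set phi f | f in [set: Cb R Y]] 1 by exact: psur.
  by rewrite -[LHS]mulr1 -f1 -pM // mul1r.
have ev z : exists y, forall f, phi f z = f y.
  apply: (@compact_character _ (fun f => phi f z)) => //.
  - by move=> f g; rewrite pD.
  - by move=> f g; rewrite pM.
  - by move=> k f; rewrite pZ.
  - by rewrite phi1.
have [h hh] := choice ev.
exists h => //; apply: cb_continuous_into => // f.
rewrite (_ : f \o h = phi f); first exact: cb_continuous.
by apply/funext => z /=; rewrite hh.
Qed.

Lemma banach_stone Y Z :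
  compact [set: Y] -> hausdorff_space Y ->
  compact [set: Z] -> hausdorff_space Z ->
  isometrically_isomorphic [set: Cb R Y] [set: Cb R Z] -> homeomorphic Z Y.
Proof.
move=> cY hY cZ hZ [phi iphi].
have [psi [ipsi phiK psiK]] := iso_inverse (cb_banach Y) iphi.
have [h ch hE] := compact_dual_map cY hY iphi.
have [k ck kE] := compact_dual_map cZ hZ ipsi.
exists h, k; split=> // [z|y]; apply: cb_separates => // f.
- by rewrite kE hE psiK.
- by rewrite hE kE phiK.
Qed.

(** The map to study is restriction along j, whose inverse extends functions
    from X to T.  It is isometric because a point where a function exceeds the
    norm of its restriction would have a neighborhood meeting the range of j;
    injectivity follows, and surjectivity is the extension property. *)
Lemma dense_extension_iso X T (j : X -> T) :
  compact [set: T] -> continuous j -> dense (range j) ->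
  (forall f : Cb R X, exists2 F : T -> R, continuous F & F \o j =1 f) ->
  isometrically_isomorphic [set: Cb R X] [set: Cb R T].
Proof.
move=> cT cj dj ext.
have cpull (g : Cb R T) : continuous (g \o j).
  by move=> x; apply: continuous_comp; [exact: cj|exact: cb_continuous].
have bpull (g : Cb R T) : bounded_fun (g \o j).
  by apply/cb_boundP; exists `|g| => x; exact: (cb_le_norm g (j x)).
pose pull (g : Cb R T) : Cb R X := cb_of (cpull g) (bpull g).
have norm_pull g : `|pull g| = `|g|.
  apply/eqP; rewrite eq_le; apply/andP; split; apply: cb_norm_le => // x.
    exact: (cb_le_norm g (j x)).
  rewrite leNgt; apply/negP => gx.
  have [||t [/= gt [y _ yt]]] := dj [set t | `|pull g| < `|g t|].
  - by exists x.
  - apply: (@open_comp _ _ (fun t => `|g t|) [set r : R | `|pull g| < r]).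
      by move=> t _; apply: cvg_norm; exact: cb_continuous.
    exact: open_gt.
  - by move: gt; rewrite -yt ltNge (cb_le_norm (pull g) y).
suff : isometric_isomorphism [set: Cb R T] [set: Cb R X] pull.
  by move=> ipull; apply: iso_sym; [exact: cb_banach|exists pull].
split=> //; try by move=> *; exact: cbP.
split=> //.
(* An additive isometry is injective. *)
- move=> f g _ _ fg; apply/eqP; rewrite -subr_eq0 -normr_eq0 -norm_pull.
  rewrite (_ : pull (f - g) = pull f - pull g); last exact: cbP.
  by rewrite fg subrr normr0.
- move=> f _; have [F cF Fj] := ext f.
  exists (cb_of cF (compact_bounded_fun cT cF)) => //.
  exact: cbP.
Qed.

End Isomorphisms.

(** * The space of a total hull *)

Section Hull.

Lemma null_hull_total (X T : topologicalType) (e : X -> T)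
    (I : set (set X)) :
  dense (range e) -> I [set: X] -> null_hull e I = [set: T].
Proof.
move=> de IT; apply/seteqP; split=> // y _; exists [set: X] => //.
have -> : closure (range e) = [set: T].
  apply/seteqP; split=> // z _ U; rewrite nbhsE => -[V [oV Vz] VU].
  have [|w [Vw ew]] := de _ _ oV; first by exists z.
  by exists w; split=> //; exact: VU.
by rewrite interiorT.
Qed.

Lemma set_type_total (T : topologicalType) (A : set T) :
  A = [set: T] -> exists2 h : T -> A, continuous h & cancel h set_val.
Proof.
move=> AT.
have inA x : x \in A by rewrite AT inE.
exists (fun x => exist _ x (inA x)) => //.
apply: continuous_comp_initial => x.
exact: cvg_id.
Qed.

Lemma set_type_hausdorff (T : topologicalType) (A : set T) :
  hausdorff_space T -> hausdorff_space A.
Proof.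
move=> hT p q pq; apply: val_inj; apply: hT => U V pU qV.
have cval : continuous (set_val : A -> T) by exact: initial_continuous.
by have [r [Ur Vr]] := pq _ _ (cval p U pU) (cval q V qV); exists (set_val r).
Qed.

End Hull.

(** * Functions vanishing at infinity on a locally null Lindelöf space *)

Theorem theorem3p13 (R : realType) (X bX : topologicalType) (e : X -> bX)
    (L I : set (set X))
    (X_regular : regular_space X) (X_hausdorff : hausdorff_space X)
    (X_lindelof : lindelof X)
    (bX_stone_cech : stone_cech R e)
    (L_semilattice : upper_semilattice L)
    (I_sigma_ideal : sigma_ideal L I)
    (X_locally_null : locally_null I) :
  let Y := null_space e I in
  [/\ (banach_algebra (@C0I R X I) /\
        isometrically_isomorphic (@C0I R X I) (@C0 R Y)),
      ([/\ locally_compact [set: Y], hausdorff_space Y &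
        forall Z : topologicalType,
          locally_compact [set: Z] -> hausdorff_space Z ->
          isometrically_isomorphic (@C0I R X I) (@C0 R Z) ->
          homeomorphic Z Y]),
      (range e `<=` null_hull e I /\
        dense [set y : Y | range e (set_val y)]),
      (@C0I R X I = @C00I R X I /\ @C0 R Y = @C00 R Y) &
      [/\ countably_compact Y,
          (compact [set: Y] <-> I [set: X]) &
          (I [set: X] <-> unital (@C0I R X I))]].
Proof.
move=> Y.
have IT : I [set: X] := lindelof_locally_null_total X_lindelof I_sigma_ideal
  X_locally_null.
have [cbX hbX [_ ce _] de ext] := bX_stone_cech.
have YT : null_hull e I = [set: bX] := null_hull_total de IT.
(* [h] and [set_val] identify bX with Y. *)
have [h ch hK] := set_type_total YT.
have cval : continuous (set_val : Y -> bX) by exact: initial_continuous.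
have cY : compact [set: Y].
  rewrite (_ : [set: Y] = h @` [set: bX]).
    by apply: continuous_compact => //; exact: continuous_subspaceT.
  apply/seteqP; split=> // y _; exists (set_val y) => //.
  by apply: val_inj; exact: hK.
have hY : hausdorff_space Y := set_type_hausdorff hbX.
have lY : locally_compact [set: Y] := compact_locally_compact cY.
have has_nbhd (A : set X) : has_null_nbhd I A.
  by exists [set: X] => //; rewrite interiorT.
have C0IE : @C0I R X I = [set: Cb R X].
  by apply/seteqP; split=> // f _ n _.
have C00IE : @C00I R X I = [set: Cb R X].
  by apply/seteqP; split=> // f _; exact: has_nbhd.
have unitalX : unital [set: Cb R X].
  by exists 1 => // f _; rewrite mul1r mulr1.
have dY : dense [set y : Y | range e (set_val y)].
  move=> O [y Oy] oO.
  have [||p [Op ep]] := de (h @^-1` O).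
  - by exists (set_val y); rewrite /= (_ : h _ = y) //; apply: val_inj; exact: hK.
  - by apply: open_comp => // p _; exact: ch.
  - by exists (h p); split; rewrite //= hK.
have isoXY : isometrically_isomorphic [set: Cb R X] [set: Cb R Y].
  apply: (@dense_extension_iso _ _ _ (h \o e)) => //.
  - by move=> x; apply: continuous_comp; [exact: ce|exact: ch].
  - move=> O O0 oO; have [y [Oy [x _ xy]]] := dY O O0 oO.
    exists y; split=> //; exists x => //; apply: val_inj.
    by rewrite /= xy; exact: hK.
  - move=> f; have [F cF Ff] := ext f; exists (F \o set_val).
      by move=> y; apply: continuous_comp; [exact: cval|exact: cF].
    by move=> x /=; rewrite hK Ff.
rewrite C0IE C00IE (compact_C0E R cY) (compact_C00E R cY).
split=> //.
- by split; first exact: cb_banach.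
- split=> // Z lZ hZ isoXZ.
  have cZ := unital_C0_compact lZ hZ (iso_unital isoXZ unitalX).
  apply: (@banach_stone R) => //; rewrite -(compact_C0E R cZ).
  exact: iso_trans (iso_sym (cb_banach R X) isoXY) isoXZ.
- by split=> //; rewrite YT.
- by split=> //; exact: compact_countably_compact.
Qed.
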